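(* Let $a,b\in\{1,2,\dots\}$ and let $G\simeq K_a\times K_b$. Then: (1) $G$ is $(2K_1+K_2)$-free; and (2) if $a,b\geq 4$, then $c(G)=3$.
   Context: All graphs are finite, simple, undirected and non-empty. $K_t$ is the complete graph on $t$ vertices. $G_1+G_2$ denotes the disjoint union of graphs and $mG$ the disjoint union of $m$ copies of $G$; thus $2K_1+K_2$ is the graph on four vertices with exactly one edge (the co-diamond). A graph $G$ is $H$-free if no induced subgraph of $G$ is isomorphic to $H$. The product $G_1\times G_2$ is the categorical (tensor) product: its vertex set is $V(G_1)\times V(G_2)$, and $(u_1,u_2)$ and $(v_1,v_2)$ are adjacent if and only if $u_1v_1\in E(G_1)$ and $u_2v_2\in E(G_2)$. So in $K_a\times K_b$ two vertices are adjacent exactly when they differ in both coordinates. Cops and robbers is a turn-based, perfect-information game played on a connected graph $G$ by a group of $k$ cops against one robber. On the first turn, the cops first each choose a starting vertex (several cops may share a vertex), then the robber chooses a starting vertex. Afterwards the cops and the robber alternate turns, starting with the cops; on the cops' turn each cop either stays on its current vertex or moves to an adjacent vertex, and on the robber's turn the robber does the same. The cops win if at some point a cop occupies the same vertex as the robber (the robber is captured); the robber wins if it escapes indefinitely. The cop number $c(G)$ is the smallest number $k$ of cops for which the cops have a winning strategy on $G$. *)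

(* Defs.v *)
From HB Require Import structures.
From mathcomp Require Import all_boot.
From mathcomp Require Import boolp.

Set Implicit Arguments.
Unset Strict Implicit.
Unset Printing Implicit Defensive.

Record sgraph := SGraph {
  vertex :> finType;
  edge : rel vertex;
  edge_sym : symmetric edge;
  edge_irr : irreflexive edge }.

Definition isomorphic (G1 G2 : sgraph) : Prop :=
  exists2 f : G1 -> G2, bijective f & {mono f : x y / edge x y}.

Section Complete.
Variable n : nat.
Definition complete_edge : rel 'I_n := fun i j => i != j.
Lemma complete_edge_sym : symmetric complete_edge.
Proof. by move=> i j; rewrite /complete_edge eq_sym. Qed.
Lemma complete_edge_irr : irreflexive complete_edge.
Proof. by move=> i; rewrite /complete_edge eqxx. Qed.
Definition complete : sgraph := SGraph complete_edge_sym complete_edge_irr.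
End Complete.

Section Union.
Variables G1 G2 : sgraph.
Definition union_edge : rel (G1 + G2)%type := fun u v =>
  match u, v with
  | inl x, inl y => edge x y
  | inr x, inr y => edge x y
  | _, _ => false
  end.
Lemma union_edge_sym : symmetric union_edge.
Proof. by move=> [x|x] [y|y] //=; exact: edge_sym. Qed.
Lemma union_edge_irr : irreflexive union_edge.
Proof. by move=> [x|x] /=; exact: edge_irr. Qed.
Definition disjoint_union : sgraph := SGraph union_edge_sym union_edge_irr.
End Union.

Section Copies.
Variables (m : nat) (G : sgraph).
Definition copies_edge : rel ('I_m * G)%type :=
  fun u v => (u.1 == v.1) && edge u.2 v.2.
Lemma copies_edge_sym : symmetric copies_edge.
Proof. by move=> u v; rewrite /copies_edge eq_sym edge_sym. Qed.
Lemma copies_edge_irr : irreflexive copies_edge.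
Proof. by move=> u; rewrite /copies_edge edge_irr andbF. Qed.
Definition copies : sgraph := SGraph copies_edge_sym copies_edge_irr.
End Copies.

Section Tensor.
Variables G1 G2 : sgraph.
Definition tensor_edge : rel (G1 * G2)%type :=
  fun u v => edge u.1 v.1 && edge u.2 v.2.
Lemma tensor_edge_sym : symmetric tensor_edge.
Proof.
by move=> u v; rewrite /tensor_edge (edge_sym u.1) (edge_sym u.2).
Qed.
Lemma tensor_edge_irr : irreflexive tensor_edge.
Proof. by move=> u; rewrite /tensor_edge edge_irr. Qed.
Definition tensor : sgraph := SGraph tensor_edge_sym tensor_edge_irr.
End Tensor.

Section Induced.
Variables (G : sgraph) (A : {set G}).
Definition induced_edge : rel {x : G | x \in A} :=
  fun u v => edge (val u) (val v).
Lemma induced_edge_sym : symmetric induced_edge.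
Proof. by move=> u v; exact: edge_sym. Qed.
Lemma induced_edge_irr : irreflexive induced_edge.
Proof. by move=> u; exact: edge_irr. Qed.
Definition induced : sgraph := SGraph induced_edge_sym induced_edge_irr.
End Induced.

Definition is_free (H G : sgraph) : Prop :=
  forall A : {set G}, ~ isomorphic (induced A) H.

Definition co_diamond : sgraph :=
  disjoint_union (copies 2 (complete 1)) (complete 2).

Section CopsAndRobbers.
Variable G : sgraph.

Definition step (x y : G) : bool := (x == y) || edge x y.

Section FixedNumberOfCops.
Variable k : nat.

Definition placement := {ffun 'I_k -> G}.

(* A round is the pair (cops' positions, robber's position) reached after the
   robber has played; the rounds are listed in chronological order. *)
Definition history := seq (placement * G).

Record cop_strategy := CopStrategy {
  cop_init : placement;
  cop_move : history -> placement;
  cop_move_legal : forall (h : history) (C : placement) (r : G) (i : 'I_k),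
    step (C i) (cop_move (rcons h (C, r)) i) }.

(* r n is the position of the robber after its (n+1)-st turn, the first turn
   being the choice of a starting vertex. *)
Definition robber_walk (r : nat -> G) : Prop := forall n, step (r n) (r n.+1).

Fixpoint play (s : cop_strategy) (r : nat -> G) (n : nat) : history :=
  if n is m.+1 then rcons (play s r m) (cop_move s (play s r m), r m.+1)
  else [:: (cop_init s, r 0)].

Definition cops_at (s : cop_strategy) (r : nat -> G) (n : nat) : placement :=
  if n is m.+1 then cop_move s (play s r m) else cop_init s.

(* The capture happens either on a robber's turn (cops and robber both at their
   n-th positions) or on a cops' turn (the cops have already moved). *)
Definition captured (s : cop_strategy) (r : nat -> G) : Prop :=
  exists (n : nat) (i : 'I_k),
    cops_at s r n i = r n \/ cops_at s r n.+1 i = r n.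

(* Quantifying over all walks covers every robber strategy, adaptive ones
   included, since the cops' strategy is deterministic. *)
Definition cops_win : Prop :=
  exists s : cop_strategy, forall r, robber_walk r -> captured s r.

End FixedNumberOfCops.

Lemma exists_cops_win : exists k, `[< cops_win k >].
Proof.
exists #|G|; apply/asboolP.
pose C0 : placement #|G| := [ffun i => enum_val i].
pose mv (h : history #|G|) := if h is u :: h' then (last u h').1 else C0.
have legal (h : history #|G|) (C : placement #|G|) (r : G) (i : 'I_#|G|) :
    step (C i) (mv (rcons h (C, r)) i).
  by case: h => [|u h] /=; rewrite ?last_rcons /step eqxx.
exists (CopStrategy C0 legal) => r _.
by exists 0, (enum_rank (r 0)); left; rewrite /= ffunE enum_rankK.
Qed.

Definition cop_number : nat := ex_minn exists_cops_win.

End CopsAndRobbers.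

(* Main.v *)
Require Import Defs.
From HB Require Import structures.
From mathcomp Require Import all_boot.
From mathcomp Require Import boolp.

Set Implicit Arguments.
Unset Strict Implicit.
Unset Printing Implicit Defensive.

(** Two vertices of [K_a x K_b] are non-adjacent iff they lie on a common line
    (row or column).  Every vertex non-adjacent to two distinct vertices of a line
    lies on that line itself, which excludes the co-diamond.  Three cops on the
    diagonal dominate the graph, since a vertex lies on two lines only, so they
    win on their first move.  Against two cops, a robber who has not been caught
    can always reach an undominated vertex: if the cops are on distinct rows and
    columns these are the two other corners of the rectangle they span, and one
    of them is within reach; if the cops share a line, the robber stays on that
    line or enters it, which four vertices per line allow. *)

Lemma exists_notin (T : finType) (s : seq T) :
  size s < #|T| -> exists x, x \notin s.
Proof.
move=> lt_sT; apply/existsP; apply: contraLR lt_sT => /existsPn s_full.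
rewrite -leqNgt; apply: leq_trans (card_size s).
by apply/subset_leq_card/subsetP => x _; have /negPn := s_full x.
Qed.

Section Game.
Variables (G : sgraph) (k : nat).

Definition dominating (C : placement G k) :=
  forall r, exists i, step (C i) r.

(** The robber's one-round invariant: if the cops' move to [C] misses the robber, its reply restores
    safety against their next move. *)
Definition evasive :=
  forall (C : placement G k) r, (forall i, C i != r) ->
    exists2 r', step r r' & forall i, ~~ step (C i) r'.

Lemma dominating_cops_win (C : placement G k) : dominating C -> cops_win G k.
Proof.
move=> domC.
pose mv (h : history G k) : placement G k :=
  (* [rev] exposes the latest round; [C] is only a default for the empty history. *)
  if rev h is (D, r) :: _ then [ffun i => if step (D i) r then r else D i]
  else C.
have legal (h : history G k) (D : placement G k) r i :
    step (D i) (mv (rcons h (D, r)) i).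
  by rewrite /mv rev_rcons ffunE; case: ifP => // _; rewrite /step eqxx.
exists (CopStrategy C legal) => r _; have [i Ci] := domC (r 0).
by exists 0, i; right; rewrite /= /mv /= ffunE Ci.
Qed.

(** The strategy [s] is deterministic, so the robber can simulate it and compute an escaping walk in
    advance. *)
Lemma evasive_not_cops_win :
  evasive -> (forall C : placement G k, exists r, forall i, C i != r) ->
  ~ cops_win G k.
Proof.
move=> evG startG [s win].
have /choice[esc escP] (Cr : placement G k * G) : exists r',
    (forall i, Cr.1 i != Cr.2) ->
    step Cr.2 r' /\ forall i, ~~ step (Cr.1 i) r'.
  have [/forallP out|/forallP in_] := boolP [forall i, Cr.1 i != Cr.2].
    by have [r' ? ?] := evG _ _ out; exists r'.
  by exists Cr.2.
(* [v0] is a fictitious position before the game: escaping from it yields a safe starting vertex. *)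
have [v0 v0P] := startG (cop_init s).
pose next (h : history G k) v :=
  rcons h (cop_move s h, esc (cop_move s h, v)).
pose st := fix st n := if n is m.+1
  then next (st m) (last (cop_init s, v0) (st m)).2
  else [:: (cop_init s, esc (cop_init s, v0))].
pose r n := (last (cop_init s, v0) (st n)).2.
have playE n : play s r n = st n.
  by elim: n => //= n ->; rewrite /r /= /next last_rcons.
have rS n : r n.+1 = esc (cops_at s r n.+1, r n).
  by rewrite /r /= /next last_rcons /= playE.
have stE n : exists h, st n = rcons h (cops_at s r n, r n).
  case: n => [|n]; first by exists [::].
  by exists (st n); rewrite rS /= playE.
have not_caught n : (forall i, ~~ step (cops_at s r n i) (r n)) ->
    forall i, cops_at s r n.+1 i != r n.
  move=> safe i; have [h sth] := stE n.
  apply: contra (safe i) => /eqP <-.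
  by rewrite [cops_at s r n.+1]/= playE sth cop_move_legal.
have safe n i : ~~ step (cops_at s r n i) (r n).
  elim: n i => [|n IHn]; first by have [] := escP (cop_init s, v0) v0P.
  by rewrite rS; have [] := escP (cops_at s r n.+1, r n) (not_caught n IHn).
have walk : robber_walk r.
  by move=> n; rewrite rS; have [] := escP (_, r n) (not_caught n (safe n)).
have [n [i [/eqP eq_cr|/eqP eq_cr]]] := win r walk.
  by have := safe n i; rewrite /step eq_cr.
by have := not_caught n (safe n) i; rewrite eq_cr.
Qed.

End Game.

Section CompleteTensor.
Variables a b : nat.
Local Notation T := (tensor (complete a) (complete b)).

Lemma tensor_completeE (u v : T) : edge u v = (u.1 != v.1) && (u.2 != v.2).
Proof. by []. Qed.

Lemma tensor_complete_nonadjacent (x y u v : T) :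
    x != y -> ~~ edge x y -> u != x -> u != y -> v != x -> v != y ->
    ~~ edge x u -> ~~ edge y u -> ~~ edge x v -> ~~ edge y v ->
  ~~ edge u v.
Proof.
case: x y u v => [x1 x2] [y1 y2] [u1 u2] [v1 v2].
rewrite !tensor_completeE /= -!pair_eqE /=.
have [<-|nx1] := eqVneq x1 y1; rewrite ?andbT ?andbF /=.
  move=> nx2 _ ux uy vx vy xu yu xv yv.
  (* Off the line of [x] and [y], a vertex non-adjacent to both would share its second coordinate
     with both, but [x2 != y2]. *)
  suff [-> ->] : u1 = x1 /\ v1 = x1 by rewrite eqxx.
  split; apply/eqP/negPn/negP => ne.
    move: xu yu; rewrite ![x1 == _]eq_sym ne /= !negbK => /eqP ex /eqP ey.
    by rewrite ex ey eqxx in nx2.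
  move: xv yv; rewrite ![x1 == _]eq_sym ne /= !negbK => /eqP ex /eqP ey.
  by rewrite ex ey eqxx in nx2.
rewrite negbK => _ /eqP <- ux uy vx vy xu yu xv yv.
suff [-> ->] : u2 = x2 /\ v2 = x2 by rewrite eqxx andbF.
split; apply/eqP/negPn/negP => ne.
  move: xu yu; rewrite ![x2 == _]eq_sym ne !andbT !negbK => /eqP ex /eqP ey.
  by rewrite ex ey eqxx in nx1.
move: xv yv; rewrite ![x2 == _]eq_sym ne !andbT !negbK => /eqP ex /eqP ey.
by rewrite ex ey eqxx in nx1.
Qed.

Lemma tensor_complete_dominating (a_ge3 : 3 <= a) (b_ge3 : 3 <= b) :
  dominating [ffun i : 'I_3 => (widen_ord a_ge3 i, widen_ord b_ge3 i) : T].
Proof.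
move=> [p q].
(* A value of [p] or [q] beyond 2 is sent to 0 by [inord]; this merely excludes one more index, and
   one of the three still remains. *)
have [|i] := @exists_notin 'I_3 [:: inord p; inord q].
  by rewrite card_ord.
rewrite !inE negb_or => /andP[ip iq]; exists i.
rewrite ffunE /step tensor_completeE /=; apply/orP; right; apply/andP; split.
  by apply: contra ip => /eqP <-; rewrite inord_val.
by apply: contra iq => /eqP <-; rewrite inord_val.
Qed.

Lemma tensor_complete_escape (c d r : T) : 4 <= a -> 4 <= b ->
    c != r -> d != r ->
  exists2 r', step r r' & ~~ step c r' && ~~ step d r'.
Proof.
move=> a_ge4 b_ge4; case: c d r => [x1 y1] [x2 y2] [p q] cr dr.
have stepE (u v : T) :
    step u v = (u == v) || (u.1 != v.1) && (u.2 != v.2) by [].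
have [ex|nx] := eqVneq x1 x2.
  subst x2; have [ep|np] := eqVneq p x1.
    subst p; exists (x1, q); first by rewrite /step eqxx.
    by rewrite !stepE (negbTE cr) (negbTE dr) /= eqxx.
  (* Avoiding [q] makes the move legal, avoiding [y1] and [y2] keeps off the cops; hence the bound
     4. *)
  have [|y] := @exists_notin 'I_b [:: q; y1; y2]; first by rewrite card_ord.
  rewrite !inE !negb_or => /and3P[yq yy1 yy2]; exists (x1, y).
    by rewrite stepE /= np [q == y]eq_sym yq orbT.
  by rewrite !stepE /= -!pair_eqE /= eqxx !orbF ![_ == y]eq_sym yy1 yy2.
have [ey|ny] := eqVneq y1 y2.
  subst y2; have [eq|nq] := eqVneq q y1.
    subst q; exists (p, y1); first by rewrite /step eqxx.
    by rewrite !stepE (negbTE cr) (negbTE dr) /= eqxx !andbF.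
  have [|x] := @exists_notin 'I_a [:: p; x1; x2]; first by rewrite card_ord.
  rewrite !inE !negb_or => /and3P[xp xx1 xx2]; exists (x, y1).
    by rewrite stepE /= nq [p == x]eq_sym xp orbT.
  by rewrite !stepE /= -!pair_eqE /= eqxx !andbT !andbF !orbF
    ![_ == x]eq_sym xx1 xx2.
have corner12 :
    ~~ step ((x1, y1) : T) (x1, y2) && ~~ step ((x2, y2) : T) (x1, y2).
  by rewrite !stepE -!pair_eqE /= [x2 == x1]eq_sym (negbTE nx) (negbTE ny)
    !eqxx !andbF.
have corner21 :
    ~~ step ((x1, y1) : T) (x2, y1) && ~~ step ((x2, y2) : T) (x2, y1).
  by rewrite !stepE -!pair_eqE /= [y2 == y1]eq_sym (negbTE nx) (negbTE ny)
    !eqxx !andbF.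
have [s12|s12] := boolP (step ((p, q) : T) (x1, y2)); first by exists (x1, y2).
have [s21|s21] := boolP (step ((p, q) : T) (x2, y1)); first by exists (x2, y1).
(* A vertex that can reach neither corner shares a line with each of them, so it is one of the cops'
   vertices. *)
move: s12 s21 cr dr; rewrite !stepE -!pair_eqE /= !negb_or !negb_and !negbK.
have [ep|np] := eqVneq p x1.
  by subst p; rewrite (negbTE nx) /= => _ /eqP ->; rewrite eqxx.
move=> /= /eqP ->; rewrite ![y2 == _]eq_sym (negbTE ny) orbF eqxx.
by move=> /andP[_ /eqP ->] _; rewrite eqxx.
Qed.

Lemma tensor_complete_evasive k : k <= 2 -> 4 <= a -> 4 <= b -> evasive T k.
Proof.
case: k => [|[|[|//]]] _ a_ge4 b_ge4 C r Cr.
- by exists r; [rewrite /step eqxx | case].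
(* A single cop counts as two cops on the same vertex. *)
- have [r' rr' /andP[safe _]] := tensor_complete_escape a_ge4 b_ge4 (Cr ord0) (Cr ord0).
  by exists r' => // i; rewrite ord1.
have [r' rr' /andP[safe0 safe1]] :=
  tensor_complete_escape a_ge4 b_ge4 (Cr ord0) (Cr ord_max).
exists r' => // i; have [->//|->//] : i = ord0 \/ i = ord_max.
by case: i => [[|[|//]] lt_i]; [left | right]; apply: val_inj.
Qed.

End CompleteTensor.

Section Isomorphism.
Variables (G H : sgraph) (f : G -> H) (g : H -> G).
Hypotheses (fK : cancel f g) (gK : cancel g f).
Hypothesis f_edge : {mono f : x y / edge x y}.

Lemma iso_step : {mono f : x y / step x y}.
Proof. by move=> x y; rewrite /step f_edge (inj_eq (can_inj fK)). Qed.

Lemma iso_dominating k (C : placement H k) :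
  dominating C -> dominating [ffun i => g (C i)].
Proof.
move=> domC r; have [i Ci] := domC (f r).
by exists i; rewrite ffunE -iso_step gK.
Qed.

Lemma iso_evasive k : evasive H k -> evasive G k.
Proof.
move=> evH C r Cr; have [|r' rr' safe] := evH [ffun i => f (C i)] (f r).
  by move=> i; rewrite ffunE (inj_eq (can_inj fK)).
exists (g r') => [|i]; first by rewrite -iso_step gK.
by have := safe i; rewrite ffunE -iso_step gK.
Qed.

End Isomorphism.

Theorem theorem5p2 (a b : nat) (G : sgraph) (a_ge1 : 1 <= a) (b_ge1 : 1 <= b)
    (isoG : isomorphic G (tensor (complete a) (complete b))) :
  is_free co_diamond G /\
  (4 <= a -> 4 <= b -> cop_number G = 3).
Proof.
case: isoG => f [g fK gK] f_edge; split.
  move=> A [h [h' hK h'K] h_edge].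
  pose w (z : co_diamond) := f (val (h' z)).
  have w_neq z1 z2 : z1 != z2 -> w z1 != w z2.
    by rewrite (inj_eq (can_inj fK)) (inj_eq val_inj) (inj_eq (can_inj h'K)).
  have w_edge z1 z2 : edge (w z1) (w z2) = edge z1 z2.
    by rewrite f_edge -[in RHS](h'K z1) -[in RHS](h'K z2) h_edge.
  (* [x] and [y] are the isolated vertices of the co-diamond, [u] and [v] the ends of its edge. *)
  pose x : co_diamond := inl (ord0, ord0).
  pose y : co_diamond := inl (ord_max, ord0).
  pose u : co_diamond := inr ord0.
  pose v : co_diamond := inr ord_max.
  have := @tensor_complete_nonadjacent a b (w x) (w y) (w u) (w v).
  by rewrite !w_edge !w_neq //; do 10!move/(_ isT).
move=> a_ge4 b_ge4; rewrite /cop_number.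
case: ex_minnP => m /asboolP m_wins m_min; apply/eqP; rewrite eqn_leq.
apply/andP; split.
  apply/m_min/asboolP.
  apply: (dominating_cops_win (iso_dominating fK gK f_edge _)).
  exact: tensor_complete_dominating (ltnW a_ge4) (ltnW b_ge4).
rewrite ltnNge; apply/negP => m_le2; apply: evasive_not_cops_win m_wins.
  exact/(iso_evasive fK gK f_edge)/tensor_complete_evasive.
(* At most two cops cannot occupy all of the at least 16 vertices. *)
move=> C; have [|r rC] := @exists_notin G (codom C).
  rewrite size_codom card_ord (bij_eq_card (Bijective fK gK)).
  rewrite card_prod !card_ord (leq_ltn_trans m_le2) //.
  exact: leq_trans (leq_mul a_ge4 b_ge4).
by exists r => i; apply: contra rC => /eqP <-; apply: codom_f.
Qed.
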